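(* Let $G$ be a countable discrete infinite amenable group acting continuously on a compact metric space $(X,d)$, let $\{F_n\}$ be a strictly increasing Følner sequence in $G$ and $\mathbf{b}=\{b(n)\}$ a scaled sequence such that $b(|F_n|)\ge |F_n|$ for all $n\in\mathbb{N}$. Let $f\in C(X,\mathbb{R})$, let $\mu$ be a Borel probability measure on $X$ and $Z\subset X$. Then for $s\in\mathbb{R}$ the following hold: (1) if $\overline{P}_\mu(x,\{F_n\},f,\mathbf{b})\le s$ for all $x\in Z$, then $P^{P}(Z,\{F_n\},f,\mathbf{b})\le s$; (2) if $\overline{P}_\mu(x,\{F_n\},f,\mathbf{b})\ge s$ for all $x\in Z$ and $\mu(Z)>0$ (with $Z$ measurable), then $P^{P}(Z,\{F_n\},f,\mathbf{b})\ge s$.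
   Context: $F(G)$ is the collection of nonempty finite subsets of $G$. A Følner sequence is a sequence $\{F_n\}_{n\in\mathbb{N}}\subseteq F(G)$ with $\lim_{n\to\infty}|F_n\triangle gF_n|/|F_n|=0$ for all $g\in G$; it is strictly increasing if $F_n\subsetneq F_{n+1}$ for all $n$. A scaled sequence is a sequence $\mathbf{b}=\{b(n)\}_{n\in\mathbb{N}}$ of positive numbers monotonically increasing to infinity. $C(X,\mathbb{R})$ is the set of continuous functions $X\to\mathbb{R}$. For $F\in F(G)$, $d_F(x,y)=\max_{g\in F}d(gx,gy)$, $B_F(x,\varepsilon)=\{y\in X:d_F(x,y)<\varepsilon\}$, $\overline{B}_F(x,\varepsilon)=\{y\in X:d_F(x,y)\le\varepsilon\}$, and $f_F(x)=\sum_{g\in F}f(gx)$. For a Borel probability measure $\mu$ and $x\in X$, $$\overline{P}_\mu(x,\{F_n\},f,\mathbf{b})=\lim_{\varepsilon\to0}\limsup_{n\to+\infty}\frac{-\log\mu(B_{F_n}(x,\varepsilon))+f_{F_n}(x)}{b(|F_n|)}.$$ For $Z\subseteq X$, $N\in\mathbb{N}$, $\alpha\in\mathbb{R}$, $\varepsilon>0$ (dependence on $\{F_n\},f,\mathbf{b}$ suppressed), $M^{P}(N,\alpha,\varepsilon,Z)=\sup\sum_i e^{-\alpha b(|F_{n_i}|)+f_{F_{n_i}}(x_i)}$, the supremum over all finite or countable pairwise disjoint collections $\{\overline{B}_{F_{n_i}}(x_i,\varepsilon)\}_i$ with $x_i\in Z$, $n_i\ge N$; $M^{P}(\alpha,\varepsilon,Z)=\lim_{N\to\infty}M^{P}(N,\alpha,\varepsilon,Z)$;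 $M^{\mathcal{P}}(\alpha,\varepsilon,Z)=\inf\{\sum_{i=1}^\infty M^{P}(\alpha,\varepsilon,Z_i):Z\subseteq\bigcup_{i=1}^\infty Z_i\}$. As a function of $\alpha$, $M^{\mathcal{P}}(\alpha,\varepsilon,Z)$ jumps from $+\infty$ to $0$ at a critical value $P^{P}(\varepsilon,Z,\{F_n\},f,\mathbf{b})=\inf\{\alpha:M^{\mathcal{P}}(\alpha,\varepsilon,Z)=0\}=\sup\{\alpha:M^{\mathcal{P}}(\alpha,\varepsilon,Z)=+\infty\}$ (with $\inf\emptyset=+\infty$, $\sup\emptyset=-\infty$), and $P^{P}(Z,\{F_n\},f,\mathbf{b})=\lim_{\varepsilon\to0}P^{P}(\varepsilon,Z,\{F_n\},f,\mathbf{b})$. *)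

(* Defs.v *)
From HB Require Import structures.
From mathcomp Require Import all_boot all_order all_algebra finmap.
From mathcomp Require Import all_classical all_reals all_analysis.

Set Implicit Arguments.
Unset Strict Implicit.
Unset Printing Implicit Defensive.

Import Order.TTheory GRing.Theory Num.Theory.
Import numFieldNormedType.Exports.

Local Open Scope classical_set_scope.
Local Open Scope ring_scope.

(* The generated sigma-algebras of the library live on pointed types, so the
   phase space carries a base point.  This is no restriction here: a space with
   a Borel probability measure is nonempty. *)
#[short(type="pmetricType")]
HB.structure Definition PMetric (K : numDomainType) :=
  {M of Pointed M & Metric K M}.

Definition borelType (R : realType) (X : pmetricType R) :=
  g_sigma_algebraType (@open X).

Section Groups.
Variables (R : realType) (G : groupType).
Implicit Types (F : nat -> {fset G}) (A : {fset G}).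

Definition ltranslate (g : G) A : {fset G} := [fset (g * h)%g | h in A]%fset.

Definition fsymdiff A B : {fset G} := ((A `\` B) `|` (B `\` A))%fset.

Definition folner F : Prop :=
  (forall n, F n != fset0) /\
  forall g : G,
    (#|` fsymdiff (F n) (ltranslate g (F n))|%fset)%:R / (#|` F n|%fset)%:R
      @[n --> \oo] --> (0 : R).

Definition amenable : Prop := exists F, folner F.

Definition strictly_increasing F : Prop :=
  forall n, (F n `<` F n.+1)%fset.

Definition scaled_sequence (b : nat -> R) : Prop :=
  [/\ forall n, 0 < b n, nondecreasing_seq b & b n @[n --> \oo] --> +oo].

End Groups.

Definition continuous_action (G : groupType) (X : topologicalType)
    (act : G -> X -> X) : Prop :=
  [/\ forall x, act 1%g x = x,
      forall g h x, act (g * h)%g x = act g (act h x) &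
      forall g, continuous (act g)].

Section Packing_pressure.
Variables (R : realType) (G : groupType) (X : pmetricType R).
Variable act : G -> X -> X.

(* The neutral element 0 of the maximum is harmless, distances being
   nonnegative. *)
Definition bowen_dist (A : {fset G}) (x y : X) : R :=
  \big[Num.max/0]_(g <- A) mdist (act g x) (act g y).

Definition bowen_ball (A : {fset G}) (x : X) (e : R) : set X :=
  [set y | bowen_dist A x y < e].

Definition bowen_cball (A : {fset G}) (x : X) (e : R) : set X :=
  [set y | bowen_dist A x y <= e].

Definition orbit_sum (f : X -> R) (A : {fset G}) (x : X) : R :=
  \sum_(g <- A) f (act g x).

Section Pressure.
Variables (F : nat -> {fset G}) (f : X -> R) (b : nat -> R).

Local Open Scope ereal_scope.

(* [lne 0 = -oo], so a ball of measure zero contributes +oo. *)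
Definition upper_local_pressure_at (mu : probability (borelType X) R)
    (e : R) (x : X) : \bar R :=
  limn_esup (fun n =>
    (- lne (mu (bowen_ball (F n) x e)) + (orbit_sum f (F n) x)%:E)
      / (b #|` F n|%fset)%:E).

Definition upper_local_pressure (mu : probability (borelType X) R)
    (x : X) : \bar R :=
  lim (upper_local_pressure_at mu e x @[e --> 0%R^'+]).

(* A finite or countable collection is a family indexed by some I : set nat;
   the values of x and k outside I are irrelevant. *)
Definition disjoint_collection (N : nat) (e : R) (Z : set X)
    (I : set nat) (x : nat -> X) (k : nat -> nat) : Prop :=
  (forall i, I i -> Z (x i) /\ (N <= k i)%N) /\
  trivIset I (fun i => bowen_cball (F (k i)) (x i) e).

Definition packing_sup (N : nat) (a e : R) (Z : set X) : \bar R :=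
  ereal_sup [set S | exists (I : set nat) (x : nat -> X) (k : nat -> nat),
    disjoint_collection N e Z I x k /\
    S = \esum_(i in I)
      (expR (- a * b #|` F (k i)|%fset + orbit_sum f (F (k i)) (x i)))%:E].

Definition packing_premeasure (a e : R) (Z : set X) : \bar R :=
  limn (fun N => packing_sup N a e Z).

Definition packing_measure (a e : R) (Z : set X) : \bar R :=
  ereal_inf [set \sum_(0 <= i <oo) packing_premeasure a e (Zs i) |
    Zs in [set Zs : nat -> set X | Z `<=` \bigcup_i Zs i]].

Definition packing_pressure_at (e : R) (Z : set X) : \bar R :=
  ereal_inf [set a%:E | a in [set a : R | packing_measure a e Z = 0]].

Definition packing_pressure (Z : set X) : \bar R :=
  lim (packing_pressure_at e Z @[e --> 0%R^'+]).

End Pressure.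
End Packing_pressure.

(* Main.v *)
Require Import Defs.
From HB Require Import structures.
From mathcomp Require Import all_boot all_order all_algebra finmap.
From mathcomp Require Import all_classical all_reals all_analysis.
From mathcomp Require Import lra.

Import Order.TTheory GRing.Theory Num.Theory.
Import numFieldNormedType.Exports.

Set Implicit Arguments.
Unset Strict Implicit.
Unset Printing Implicit Defensive.

Local Open Scope classical_set_scope.
Local Open Scope ring_scope.

(** Write w beta n x for the packing weight exp (- beta b(|F_n|) + f_{F_n}(x)).
    Unfolding the logarithm ([quotient_leE]), the n-th quotient in the local
    pressure at x is at most beta exactly when w beta n x is at most the measure
    of the Bowen ball around x.  So bounds on the local pressure compare packing
    sums with sums of measures of Bowen balls.  Raising the exponent by some
    delta > 0 multiplies the weight by exp (- delta b(|F_n|)), and since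
    b(|F_n|) >= |F_n| >= n this factor is at most q ^ n with
    q = exp (- delta) < 1.

    Upper bound.  Let s < beta < a.  For a fixed radius, Z is the union over N
    of the sets of points at which, for all n >= N, the weight with exponent
    beta is at most the measure of the ball.  The balls of a packing of one of
    these sets are disjoint and have total mass at most 1, so its packing sums
    with exponent a are at most q ^ N, for all large N
    ([packing_sup_le_geometric]).  All these sets have zero premeasure, hence Z
    has zero packing measure for a.

    Lower bound.  Let a < beta < s.  For some fixed radius, the points of Z
    whose quotients exceed beta infinitely often form a set of positive outer
    measure, and every countable cover of Z contains a set that meets it in
    some E of positive outer measure.  If E_n collects the points of E where
    the n-th quotient exceeds beta, a maximal separated subset of E_n gives a
    packing whose enlarged balls cover E_n, so the outer measure of E_n is at
    most q ^ n times the packing supremum ([outer_le_packing_sup]).  As E is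
    contained in the union of the E_n with n >= N for every N, a finite
    premeasure would bound the outer measure of E by multiples of the tails of
    a convergent geometric series, hence by zero ([packing_premeasure_eqy]).
    So the premeasure of E is infinite.  Outer measure appears because E
    depends on an arbitrary cover of Z and may fail to be measurable. *)

(** * One-sided and superior limits of extended-real functions *)

(** The dictionary between local pressure and packing weights.  For a null ball
    the quotient is [+oo] and the weight is positive, so that both sides are
    false. *)
Lemma quotient_leE (R : realType) (m : \bar R) (phi b beta : R) :
  (0 <= m)%E -> (m <= 1)%E -> 0 < b ->
  ((- lne m + phi%:E) / b%:E <= beta%:E)%E =
  ((expR (- beta * b + phi))%:E <= m)%E.
Proof.
move=> m0 m1 b0.
have mfin : m \is a fin_num by rewrite ge0_fin_numE// (le_lt_trans m1)// ltry.
rewrite inver gt_eqF// lee_pdivrMr//.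
move: m mfin m0 m1 => [r| |]// _; rewrite lee_fin => r0 r1.
have [rp|] := ltP 0 r; last first.
  move=> r0'; have -> : r = 0 by apply/le_anti; rewrite r0 r0'.
  by rewrite le0_lneNy//= leNgt ltry/= lee_fin leNgt expR_gt0.
rewrite lne_EFin// -EFinN -EFinD -EFinM !lee_fin.
rewrite -[r in RHS]lnK ?posrE// ler_expR.
by rewrite mulNr; apply/idP/idP => ?; lra.
Qed.

Lemma lim_at_right0 (R : realType) (f : R -> \bar R) :
  (forall e e', 0 < e -> e <= e' -> (f e' <= f e)%E) ->
  lim (f e @[e --> 0^'+]) = ereal_sup [set f e | e in [set e | 0 < e]].
Proof.
move=> fni; apply/cvg_lim => //.
rewrite (_ : [set e | 0 < e] = [set` `]0, +oo[]); last first.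
  by apply/seteqP; split => e /=; rewrite in_itv/= andbT.
apply: nonincreasing_at_right_cvge => // e e'.
by rewrite !in_itv/= !andbT => e0 _ ee'; exact: fni.
Qed.

Lemma limn_esup_lt (R : realType) (u : (\bar R)^nat) (l : \bar R) :
  (limn_esup u < l)%E -> exists N, forall n, (N <= n)%N -> (u n < l)%E.
Proof.
rewrite /limn_esup limf_esupE => /ereal_inf_lt[_ [V [N _ NV] <-]] ul.
exists N => n Nn; apply: le_lt_trans ul; apply: ereal_sup_ubound.
by exists n => //; exact: NV.
Qed.

Lemma limn_esup_gt (R : realType) (u : (\bar R)^nat) (l : \bar R) :
  (l < limn_esup u)%E -> forall N, exists2 n, (N <= n)%N & (l < u n)%E.
Proof.
rewrite /limn_esup limf_esupE => lu N.
have /ereal_sup_gt[_ [n /= Nn <-] lun] :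
    (l < ereal_sup (u @` [set n | (N <= n)%N]))%E.
  apply: lt_le_trans lu _; apply: ereal_inf_lbound.
  by exists [set n | (N <= n)%N] => //; exists N.
by exists n.
Qed.

(** * The Bowen metrics *)

Section Bowen_metric.
Variables (R : realType) (G : groupType) (X : pmetricType R).
Variable act : G -> X -> X.
Implicit Types (A : {fset G}) (x y z : X) (e : R).

Lemma bowen_dist_ge0 A x y : 0 <= bowen_dist act A x y.
Proof. by rewrite /bowen_dist; exact: bigmax_ge_id. Qed.

Lemma mdist_le_bowen_dist A x y g : g \in A ->
  mdist (act g x) (act g y) <= bowen_dist act A x y.
Proof.
move=> gA; rewrite /bowen_dist.
pose d h := mdist (act h x) (act h y).
exact: (@le_bigmax_seq _ _ _ _ 0 g xpredT d gA isT).
Qed.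

Lemma bowen_dist_le A x y e : 0 <= e ->
  (forall g, g \in A -> mdist (act g x) (act g y) <= e) ->
  bowen_dist act A x y <= e.
Proof.
move=> e0 le_e; rewrite /bowen_dist big_seq.
by apply/bigmax_le => // g; exact: le_e.
Qed.

Lemma bowen_dist_xx A x : bowen_dist act A x x = 0.
Proof.
apply/le_anti; rewrite bowen_dist_ge0 andbT.
by apply: bowen_dist_le => // g _; rewrite mdistxx.
Qed.

Lemma bowen_dist_sym A x y : bowen_dist act A x y = bowen_dist act A y x.
Proof. by rewrite /bowen_dist; apply: eq_bigr => g _; rewrite metric_sym. Qed.

Lemma bowen_dist_triangle A x y z :
  bowen_dist act A x z <= bowen_dist act A x y + bowen_dist act A y z.
Proof.
apply: bowen_dist_le => [|g gA]; first by rewrite addr_ge0// bowen_dist_ge0.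
apply: le_trans (metric_triangle _ (act g y) _) _.
by apply: lerD; exact: mdist_le_bowen_dist.
Qed.

Hypothesis actC : forall g, continuous (act g).

(** Only finitely many elements of the group act in a Bowen metric, so the
    continuity of each of them makes Bowen balls neighbourhoods. *)
Lemma bowen_ball_nbhs A y e : 0 < e ->
  \forall z \near y, bowen_ball act A y e z.
Proof.
move=> e0.
have e20 : 0 < e / 2 by rewrite divr_gt0.
have near_s (s : seq G) : \forall z \near y, forall g, g \in s ->
    mdist (act g y) (act g z) < e / 2.
  elim: s => [|g s IH]; first exact: nearW.
  have gy : \forall z \near y, mdist (act g y) (act g z) < e / 2.
    by apply: (metricType_numDomainType.cvgr_dist_lt _ e20); exact: actC.
  apply: filterS2 gy IH => z gz sz h; rewrite inE => /orP[/eqP->//|]; exact: sz.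
apply: filterS (near_s A) => z Az; rewrite /bowen_ball/=.
apply: (@le_lt_trans _ _ (e / 2)).
  by apply: bowen_dist_le => [|g gA]; [exact: ltW|exact/ltW/Az].
by rewrite ltr_pdivrMr// ltr_pMr// ltr1n.
Qed.

Lemma bowen_ball_open A x e : open (bowen_ball act A x e).
Proof.
rewrite openE => y /= xye; rewrite /interior.
have d0 : 0 < e - bowen_dist act A x y by rewrite subr_gt0.
apply: filterS (bowen_ball_nbhs A y d0) => z; rewrite /bowen_ball/= => yz.
by apply: le_lt_trans (bowen_dist_triangle A x y z) _; rewrite -ltrBrDl.
Qed.

Lemma measurable_bowen_ball A x e :
  measurable (bowen_ball act A x e : set (borelType X)).
Proof. by apply: sub_sigma_algebra; exact: bowen_ball_open. Qed.

(** Induction on the centers: if E meets the ball of radius r / 2 around the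
    first one, pick a point there and discard from E all points within r of it;
    this empties that ball, so the remaining centers cover what is left. *)
Lemma greedy_separated A (cs : seq X) (E : set X) r :
  (forall y, E y -> exists2 c, c \in cs & bowen_dist act A c y < r / 2) ->
  exists xs : seq X, [/\ forall x, x \in xs -> E x,
    pairwise (fun x y => r < bowen_dist act A x y) xs &
    forall y, E y -> exists2 x, x \in xs & bowen_dist act A x y <= r].
Proof.
elim: cs E => [|c cs IH] E Ecs.
  by exists [::]; split => // y /Ecs[].
have [[x [Ex cx]]|noc] :=
    pselect (exists x, E x /\ bowen_dist act A c x < r / 2).
  have [|xs [xsE xssep xscov]] := IH (E `&` [set y | r < bowen_dist act A x y]).
    move=> y [Ey /= xy]; have [c' + c'y] := Ecs y Ey.
    rewrite inE => /orP[/eqP cc'|c'cs]; last by exists c'.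
    move: xy; rewrite ltNge => /negP; case.
    rewrite cc' in c'y; rewrite [leRHS]splitr.
    apply: (le_trans (bowen_dist_triangle A x c y)).
    by rewrite bowen_dist_sym lerD// ltW.
  exists (x :: xs); split.
  - by move=> y; rewrite inE => /orP[/eqP->//|/xsE[]].
  - by rewrite /= xssep andbT; apply/allP => y /xsE[].
  - move=> y Ey; have [xy|xy] := leP (bowen_dist act A x y) r.
      by exists x => //; rewrite mem_head.
    have [z zxs zy] := xscov y (conj Ey xy).
    by exists z => //; rewrite inE zxs orbT.
apply: IH => y Ey; have [c' + c'y] := Ecs y Ey.
rewrite inE => /orP[/eqP cc'|c'cs]; last by exists c'.
by case: noc; exists y; rewrite -cc'.
Qed.

Lemma finite_separated A (E : set X) r : compact [set: X] -> 0 < r ->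
  exists xs : seq X, [/\ forall x, x \in xs -> E x,
    pairwise (fun x y => r < bowen_dist act A x y) xs &
    forall y, E y -> exists2 x, x \in xs & bowen_dist act A x y <= r].
Proof.
move=> cptX r0.
have : cover_compact [set: X] by rewrite -compact_cover.
move=> /(_ X setT (fun x => bowen_ball act A x (r / 2))) [|x _|cs _ Xcs].
- by move=> x _; exact: bowen_ball_open.
- by exists x => //; rewrite /bowen_ball/= bowen_dist_xx divr_gt0.
- apply: (@greedy_separated A cs) => y _.
  by have [c /= ccs cy] := Xcs y I; exists c.
Qed.

End Bowen_metric.

(** * Monotonicity in the radius *)

Section Packing_monotonicity.
Variables (R : realType) (G : groupType) (X : pmetricType R).
Variable act : G -> X -> X.
Variables (F : nat -> {fset G}) (f : X -> R) (b : nat -> R).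
Implicit Types (a e : R) (Z : set X).

Lemma le_packing_sup N N' a e e' Z Z' : (N <= N')%N -> e' <= e -> Z `<=` Z' ->
  (packing_sup act F f b N' a e Z <= packing_sup act F f b N a e' Z')%E.
Proof.
move=> NN' e'e ZZ'; apply: le_ereal_sup => _ [I [x [k [[kP tkP] ->]]]].
exists I, x, k; split => //; split.
  by move=> i /kP[/ZZ' ? /(leq_trans NN')].
move=> i j Ii Ij [y [yi yj]]; apply: tkP => //.
by exists y; split; [exact: le_trans yi _|exact: le_trans yj _].
Qed.

Lemma packing_sup_ge0 N a e Z : (0 <= packing_sup act F f b N a e Z)%E.
Proof.
apply: ereal_sup_ubound; exists set0, (fun=> point), (fun=> 0%N).
by rewrite esum_set0; split => //; split => // i j [].
Qed.

Lemma is_cvg_packing_sup a e Z :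
  cvgn (fun N => packing_sup act F f b N a e Z).
Proof.
by apply: ereal_nonincreasing_is_cvgn => N N' NN'; exact: le_packing_sup.
Qed.

Lemma packing_premeasure_ge0 a e Z :
  (0 <= packing_premeasure act F f b a e Z)%E.
Proof.
apply: lime_ge; first exact: is_cvg_packing_sup.
by apply: nearW => N; exact: packing_sup_ge0.
Qed.

Lemma le_packing_premeasure a e e' Z Z' : e' <= e -> Z `<=` Z' ->
  (packing_premeasure act F f b a e Z <=
   packing_premeasure act F f b a e' Z')%E.
Proof.
move=> e'e ZZ'; apply: lee_lim; [exact: is_cvg_packing_sup..|].
by apply: nearW => N; exact: le_packing_sup.
Qed.

Lemma packing_measure_ge0 a e Z : (0 <= packing_measure act F f b a e Z)%E.
Proof.
apply: le_ereal_inf_tmp => _ [Zs _ <-].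
by apply: nneseries_ge0 => n _ _; exact: packing_premeasure_ge0.
Qed.

Lemma le_packing_measure a e e' Z : e' <= e ->
  (packing_measure act F f b a e Z <= packing_measure act F f b a e' Z)%E.
Proof.
move=> e'e; apply: le_ereal_inf_tmp => _ [Zs ZZs <-].
apply: (@le_trans _ _
  (\sum_(0 <= i <oo) packing_premeasure act F f b a e (Zs i))%E).
  by apply: ereal_inf_lbound; exists Zs.
apply: lee_nneseries => [i _ _|i _]; first exact: packing_premeasure_ge0.
exact: le_packing_premeasure.
Qed.

(** Smaller radii allow more disjoint collections, so the limit as the radius
    tends to 0 is a supremum. *)
Lemma packing_pressureE Z : packing_pressure act F f b Z =
  ereal_sup [set packing_pressure_at act F f b e Z | e in [set e | 0 < e]].
Proof.
apply: lim_at_right0 => e e' e0 ee'.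
apply: le_ereal_inf => _ [a /= a0 <-]; exists a => //=.
by apply/le_anti; rewrite packing_measure_ge0 andbT -a0 le_packing_measure.
Qed.

End Packing_monotonicity.

Section Local_pressure.
Variables (R : realType) (G : groupType) (X : pmetricType R).
Variable act : G -> X -> X.
Variables (F : nat -> {fset G}) (f : X -> R) (b : nat -> R).
Variable mu : probability (borelType X) R.
Hypothesis actC : forall g, continuous (act g).
Hypothesis b_gt0 : forall n, 0 < b n.

Lemma le_upper_local_pressure_at e e' x : e <= e' ->
  (upper_local_pressure_at act F f b mu e' x <=
   upper_local_pressure_at act F f b mu e x)%E.
Proof.
move=> ee'; rewrite /upper_local_pressure_at /limn_esup !limf_esupE.
apply: le_ereal_inf_tmp => _ [V NV <-].
apply: (@le_trans _ _ (ereal_sup ((fun n =>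
    (- lne (mu (bowen_ball act (F n) x e')) +
     (orbit_sum act f (F n) x)%:E) / (b #|` F n|%fset)%:E)%E @` V))).
  by apply: ereal_inf_lbound; exists V.
apply: ge_ereal_sup => _ [n Vn <-].
apply: le_trans; last by apply: ereal_sup_ubound; exists n.
rewrite inver gt_eqF ?b_gt0// lee_wpmul2r ?lee_fin ?invr_ge0 ?(ltW (b_gt0 _))//.
rewrite leeD// leeN2 lee_lne ?in_itv/= ?measure_ge0 ?leey//.
apply: le_measure; rewrite ?inE; [exact: measurable_bowen_ball..|].
by move=> y /lt_le_trans; exact.
Qed.

Lemma upper_local_pressureE x : upper_local_pressure act F f b mu x =
  ereal_sup [set upper_local_pressure_at act F f b mu e x |
    e in [set e | 0 < e]].
Proof.
by apply: lim_at_right0 => e e' _; exact: le_upper_local_pressure_at.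
Qed.

End Local_pressure.

(** * Upper bound for the packing pressure *)

Section Upper_bound.
Variables (R : realType) (G : groupType) (X : pmetricType R).
Variable act : G -> X -> X.
Variables (F : nat -> {fset G}) (f : X -> R) (b : nat -> R).
Variable mu : probability (borelType X) R.
Hypothesis actC : forall g, continuous (act g).
Hypothesis b_gt0 : forall n, 0 < b n.
Hypothesis b_ge : forall n, n%:R <= b #|` F n|%fset.

Local Notation weight a n x :=
  (expR (- a * b #|` F n|%fset + orbit_sum act f (F n) x)).

(** The balls of a packing are disjoint, so their measures add up to at most 1;
    passing from beta to a contributes the geometric factor. *)
Lemma packing_sup_le_geometric N a beta e Z : beta <= a ->
  (forall x n, Z x -> (N <= n)%N ->
    ((weight beta n x)%:E <= mu (bowen_ball act (F n) x e))%E) ->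
  (packing_sup act F f b N a e Z <= (expR (- (a - beta)) ^+ N)%:E)%E.
Proof.
move=> ba wmu; apply: ge_ereal_sup => _ [I [x [k [[kP tkP] ->]]]].
rewrite -(set_mem_set I) -nneseries_esum; last first.
  by move=> i _; rewrite lee_fin expR_ge0.
have mB n : measurable (bowen_ball act (F (k n)) (x n) e : set (borelType X)).
  exact: measurable_bowen_ball.
have mu_le1 : (mu (\bigcup_(n in I) bowen_ball act (F (k n)) (x n) e) <= 1)%E.
  by apply: probability_le1; exact: bigcup_measurable.
rewrite measure_bigcup// in mu_le1; last first.
  move=> i j Ii Ij [y [yi yj]]; apply: tkP => //.
  by exists y; split; exact: ltW.
apply: (@le_trans _ _ ((expR (- (a - beta)) ^+ N)%:E *
    \sum_(0 <= i <oo | i \in I) mu (bowen_ball act (F (k i)) (x i) e))%E);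
    last by rewrite -[leRHS]mule1 lee_wpmul2l// lee_fin exprn_ge0// expR_ge0.
rewrite -nneseriesZl//; apply: lee_nneseries => [i _ _|i].
  by rewrite lee_fin expR_ge0.
rewrite inE => /kP[Zxi Nki].
apply: le_trans (_ : _ <= (expR (- (a - beta)) ^+ N)%:E *
    (weight beta (k i) (x i))%:E)%E _.
  (* expR (- (a - beta)) ^+ N bounds the ratio of the two weights because the
     index of each ball is at least N and its exponent at least its index *)
  rewrite -EFinM lee_fin -expRM_natl -expRD ler_expR.
  have : N%:R <= b #|` F (k i)|%fset.
    by apply: le_trans (b_ge _); rewrite ler_nat.
  have : 0 <= a - beta by lra.
  nra.
by rewrite lee_wpmul2l ?lee_fin ?exprn_ge0 ?expR_ge0// wmu.
Qed.

Lemma packing_premeasure_eq0 N a beta e Z : beta < a ->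
  (forall x n, Z x -> (N <= n)%N ->
    ((weight beta n x)%:E <= mu (bowen_ball act (F n) x e))%E) ->
  packing_premeasure act F f b a e Z = 0.
Proof.
move=> ba wmu; apply/cvg_lim => //.
pose q := expR (- (a - beta)).
have q_lt1 : `|q| < 1.
  by rewrite ger0_norm ?expR_ge0// expR_lt1 oppr_lt0 subr_gt0.
apply: (@squeeze_cvge _ _ _ _ (fun=> 0%E) _ (fun n => (q ^+ n)%:E)).
- exists N => // n /= Nn; rewrite packing_sup_ge0/=.
  apply: (packing_sup_le_geometric (ltW ba)) => x k Zx nk.
  by apply: wmu => //; exact: leq_trans nk.
- exact: cvg_cst.
- by apply: cvg_EFin; [exact: nearW|exact: cvg_expr].
Qed.

(** Points are sorted by the rank from which their balls dominate their weights;
    each of these countably many pieces has zero premeasure. *)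
Lemma packing_pressure_le s Z :
  (forall x, Z x -> (upper_local_pressure act F f b mu x <= s%:E)%E) ->
  (packing_pressure act F f b Z <= s%:E)%E.
Proof.
move=> Zs; rewrite packing_pressureE; apply: ge_ereal_sup => _ [e /= e0 <-].
apply/lee_addgt0Pr => t t0.
apply: ereal_inf_lbound; exists (s + t) => //=.
(* any exponent strictly between s and s + t works *)
pose beta := s + t / 2.
have beta_lt : beta < s + t by rewrite ltrD2l ltr_pdivrMr// ltr_pMr// ltr1n.
pose Zge N := [set x | Z x /\ forall n, (N <= n)%N ->
  ((weight beta n x)%:E <= mu (bowen_ball act (F n) x e))%E].
apply/le_anti; rewrite packing_measure_ge0 andbT.
apply: ereal_inf_lbound; exists Zge.
  move=> x Zx.
  have : (upper_local_pressure_at act F f b mu e x < beta%:E)%E.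
    apply: (@le_lt_trans _ _ s%:E); last by rewrite lte_fin ltrDl divr_gt0.
    apply: le_trans (Zs _ Zx); rewrite (upper_local_pressureE _ _ _ actC b_gt0).
    by apply: ereal_sup_ubound; exists e.
  move=> /limn_esup_lt[N xN]; exists N => //; split => // n /xN/ltW.
  rewrite quotient_leE ?b_gt0//.
  by apply: probability_le1; exact: measurable_bowen_ball.
apply: eseries0 => N _ _; apply: (packing_premeasure_eq0 (N := N)) beta_lt _.
by move=> x n [_]; exact.
Qed.

End Upper_bound.

(** * Lower bound for the packing pressure *)

Section Lower_bound.
Variables (R : realType) (G : groupType) (X : pmetricType R).
Variable act : G -> X -> X.
Variables (F : nat -> {fset G}) (f : X -> R) (b : nat -> R).
Variable mu : probability (borelType X) R.
Hypothesis actC : forall g, continuous (act g).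
Hypothesis cptX : compact [set: X].
Hypothesis b_gt0 : forall n, 0 < b n.
Hypothesis b_ge : forall n, n%:R <= b #|` F n|%fset.

Local Notation weight a n x :=
  (expR (- a * b #|` F n|%fset + orbit_sum act f (F n) x)).
Local Notation outer := (mu^*)%mu.

Lemma outer_gt0_piece (E : set X) (A : nat -> set X) :
  E `<=` \bigcup_i A i -> (0 < outer E)%E ->
  exists i, (0 < outer (E `&` A i))%E.
Proof.
move=> EA; apply: contraPP => /forallNP E0; apply/negP; rewrite -leNgt.
have EEA : E `<=` \bigcup_i (E `&` A i).
  by move=> x Ex; have [i _ Aix] := EA x Ex; exists i.
apply: (le_trans (le_mu_ext mu EEA)).
apply: (le_trans (mu_ext_sigma_subadditive (measure_ge0 mu) _)).
rewrite eseries0// => i _ _; apply: le_anti; apply/andP.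
split; last exact: mu_ext_ge0.
by rewrite leNgt; apply/negP/E0.
Qed.

(** A 2e-separated subset of E that is maximal serves twice: its closed balls of
    radius e are disjoint, hence form an admissible packing, and its balls of
    radius 3e cover E, which bounds the outer measure of E by weights. *)
Lemma outer_le_packing_sup n a beta e (E : set X) : 0 < e -> a <= beta ->
  (forall x, E x ->
    (mu (bowen_ball act (F n) x (3 * e)) <= (weight beta n x)%:E)%E) ->
  (outer E <= (expR (- (beta - a)) ^+ n)%:E * packing_sup act F f b n a e E)%E.
Proof.
move=> e0 ab muE.
have [xs [xsE sep cov]] := finite_separated actC (F n) E cptX
  (mulr_gt0 (ltr0Sn R 1) e0).
(* [point] is a dummy default: only indices below [size xs] are used *)
pose c i := nth point xs i.
have mB i : measurable (bowen_ball act (F n) (c i) (3 * e) : set (borelType X)).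
  exact: measurable_bowen_ball.
have EB : E `<=`
    \big[setU/set0]_(i < size xs) bowen_ball act (F n) (c i) (3 * e).
  move=> y /cov[x xxs xy].
  rewrite -(bigcup_mkord _ (fun i => bowen_ball act (F n) (c i) (3 * e))).
  exists (index x xs); rewrite /= ?index_mem// /c nth_index//.
  by rewrite /bowen_ball/=; apply: le_lt_trans xy _; rewrite ltr_pM2r// ltr_nat.
apply: (le_trans (le_mu_ext mu EB)).
rewrite measurable_mu_extE; last exact: bigsetU_measurable.
apply: (le_trans (@Boole_inequality _ _ _ mu
  (fun i => bowen_ball act (F n) (c i) (3 * e)) _ (fun i _ => mB i))).
apply: (@le_trans _ _ ((expR (- (beta - a)) ^+ n)%:E *
    \sum_(i < size xs) (weight a n (c i))%:E)%E).
  rewrite ge0_sume_distrr; last by move=> i _; rewrite lee_fin expR_ge0.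
  apply: lee_sum => i _.
  apply: (le_trans (muE _ (xsE _ (mem_nth _ (ltn_ord i))))).
  rewrite -EFinM lee_fin -expRM_natl -expRD ler_expR.
  (* the weights for a and beta differ by the factor
     expR ((beta - a) * b #|F n|), and b #|F n| is at least n *)
  have := b_ge n; have : 0 <= beta - a by lra.
  nra.
rewrite lee_wpmul2l ?lee_fin ?exprn_ge0 ?expR_ge0//.
apply: ereal_sup_ubound; exists `I_(size xs), c, (fun=> n); split; last first.
  rewrite esum_fset; [by rewrite -fsbig_ord|exact: finite_II|].
  by move=> i _; rewrite lee_fin expR_ge0.
split.
  by move=> i /= ilt; split=> //; apply/xsE/mem_nth.
have disj i j : (i < j)%N -> (j < size xs)%N ->
    ~ (bowen_cball act (F n) (c i) e `&` bowen_cball act (F n) (c j) e !=set0).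
  move=> ij js [y [yi yj]].
  have /(pairwiseP point)/(_ i j) := sep.
  rewrite !inE => /(_ (ltn_trans ij js) js ij); apply/negP; rewrite -leNgt.
  apply: (le_trans (bowen_dist_triangle act (F n) (c i) y (c j))).
  by rewrite mulr_natl mulr2n lerD// bowen_dist_sym.
move=> i j /= si sj ne; case: (ltngtP i j) => // ij.
  by case: (disj i j).
by case: (disj j i) => //; rewrite setIC.
Qed.

(** Every tail of the indices accounts for all of E, and index n accounts for
    outer measure at most q ^ n times the packing supremum.  If the packing
    suprema were eventually bounded by K, then E would have outer measure at
    most K q ^ N / (1 - q) for all large N, hence outer measure zero.  Here
    q = exp (- (beta - a)). *)
Lemma packing_premeasure_eqy a beta e (E : set X) : 0 < e -> a < beta ->
  (0 < outer E)%E ->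
  (forall x N, E x -> exists2 n, (N <= n)%N &
    (mu (bowen_ball act (F n) x (3 * e)) <= (weight beta n x)%:E)%E) ->
  packing_premeasure act F f b a e E = +oo%E.
Proof.
move=> e0 ab E0 muE; apply: contrapT => /eqP; rewrite -ltey => fin.
pose q := expR (- (beta - a)).
have q0 : 0 < q by exact: expR_gt0.
have q_lt1 : q < 1 by rewrite expR_lt1 oppr_lt0 subr_gt0.
have [K [K0 [N0 supK]]] : exists K, 0 <= K /\
    exists N0, forall N, (N0 <= N)%N ->
    (packing_sup act F f b N a e E <= K%:E)%E.
  have ni : nonincreasing_seq (fun N => packing_sup act F f b N a e E).
    by move=> N N' NN'; exact: le_packing_sup.
  move: fin; rewrite /packing_premeasure.
  rewrite (cvg_lim _ (ereal_nonincreasing_cvgn ni))//.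
  move=> /ereal_inf_lt[_ [N0 _ <-]] fin.
  have fin' : packing_sup act F f b N0 a e E \is a fin_num.
    by rewrite ge0_fin_numE// packing_sup_ge0.
  exists (fine (packing_sup act F f b N0 a e E)).
  split; first by rewrite fine_ge0// packing_sup_ge0.
  by exists N0 => N N0N; rewrite fineK// le_packing_sup.
have outerK N : (N0 <= N)%N -> (outer E <= (K / (1 - q) * q ^+ N)%:E)%E.
  move=> N0N.
  pose En j := [set x | E x /\ (mu (bowen_ball act (F (N + j)) x (3 * e)) <=
     (weight beta (N + j) x)%:E)%E].
  have EEn : E `<=` \bigcup_j En j.
    move=> x Ex; have [n Nn xn] := muE x N Ex.
    by exists (n - N)%N => //; rewrite /En/= subnKC.
  apply: (le_trans (le_mu_ext mu EEn)).
  apply: (le_trans (mu_ext_sigma_subadditive (measure_ge0 mu) En)).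
  apply: lime_le; first by apply: is_cvg_nneseries => n _ _; exact: mu_ext_ge0.
  apply: nearW => m.
  apply: (@le_trans _ _ (\sum_(0 <= j < m) (K * q ^+ N * q ^+ j)%:E)%E).
    apply: lee_sum => j _.
    apply: (le_trans (outer_le_packing_sup (n := (N + j)%N) e0 (ltW ab) _)).
      by move=> x [].
    rewrite -mulrA -exprD mulrC EFinM.
    rewrite lee_wpmul2l ?lee_fin ?exprn_ge0 ?expR_ge0//.
    apply: le_trans (supK N N0N).
    by apply: le_packing_sup => //; [exact: leq_addr|move=> x []].
  rewrite sumEFin lee_fin.
  have Kq0 : 0 <= K * q ^+ N by rewrite mulr_ge0// exprn_ge0// ltW.
  have := geometric_le_lim m Kq0 q0; rewrite gtr0_norm// => /(_ q_lt1).
  by rewrite mulrAC /series/=.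
suff : (outer E <= 0)%E by rewrite leNgt E0.
apply: (@cvge_to_ge _ \oo _ _ (fun N => (K / (1 - q) * q ^+ N)%:E)).
  apply: cvg_EFin; first exact: nearW.
  by apply: cvg_geometric; rewrite gtr0_norm.
by exists N0 => // N; exact: outerK.
Qed.

(** Outer measure passes twice to a piece of a countable cover: first to the
    points whose local pressure is detected at one radius 1 / (m + 1), then to
    the trace of one set of an arbitrary cover of Z. *)
Lemma packing_pressure_ge s Z : (0 < outer Z)%E ->
  (forall x, Z x -> (s%:E <= upper_local_pressure act F f b mu x)%E) ->
  (s%:E <= packing_pressure act F f b Z)%E.
Proof.
move=> Z0 sZ; apply/lee_subgt0Pr => t t0; rewrite -EFinB.
pose beta := s - t.
pose Zm m := [set x | Z x /\
  (beta%:E < upper_local_pressure_at act F f b mu m.+1%:R^-1 x)%E].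
have ZZm : Z `<=` \bigcup_m Zm m.
  move=> x Zx.
  have : (beta%:E < upper_local_pressure act F f b mu x)%E.
    by apply: lt_le_trans (sZ _ Zx); rewrite lte_fin ltrBlDr ltrDl.
  rewrite (upper_local_pressureE _ _ _ actC b_gt0).
  move=> /ereal_sup_gt[_ [e /= e0 <-]] xe.
  have [m me] : exists m, m.+1%:R^-1 <= e.
    exists (Num.truncn e^-1); rewrite -[leRHS]invrK lef_pV2 ?posrE ?invr_gt0//.
    by apply/ltW/truncnS_gt.
  exists m => //; split => //; apply: lt_le_trans xe _.
  exact: le_upper_local_pressure_at.
have [m Em0] := outer_gt0_piece ZZm Z0.
(* a third, because packings of radius e are compared with balls of radius
   3e *)
pose e : R := m.+1%:R^-1 / 3.
have e0 : 0 < e by rewrite divr_gt0// invr_gt0.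
have e3 : 3 * e = m.+1%:R^-1 by rewrite mulrC divfK.
rewrite packing_pressureE.
apply: (@le_trans _ _ (packing_pressure_at act F f b e Z)); last first.
  by apply: ereal_sup_ubound; exists e.
apply: le_ereal_inf_tmp => _ [a /= a0 <-].
rewrite lee_fin leNgt; apply/negP => ab.
suff : packing_measure act F f b a e Z = +oo%E by rewrite a0.
apply/eqP; rewrite -leye_eq; apply: le_ereal_inf_tmp => _ [Zs ZZs <-].
have ZmZs : (Z `&` Zm m) `<=` \bigcup_i Zs i by move=> x [/ZZs].
have [i Ei0] := outer_gt0_piece ZmZs Em0.
rewrite (@nneseries_pinfty _ _ _ i)// => [k _|].
  exact: packing_premeasure_ge0.
apply/eqP; rewrite -leye_eq.
rewrite -(packing_premeasure_eqy e0 ab Ei0); last first.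
  move=> x N [[_ [_ /limn_esup_gt/(_ N)[n Nn xn]]] _]; exists n => //.
  move: xn; rewrite ltNge quotient_leE ?b_gt0//.
    by rewrite -ltNge e3 => /ltW.
  by apply: probability_le1; exact: measurable_bowen_ball.
by apply: le_packing_premeasure => // x [].
Qed.

End Lower_bound.

(** * The two bounds combined *)

Lemma leq_card_increasing (G : groupType) (F : nat -> {fset G}) n :
  strictly_increasing F -> (n <= #|` F n|%fset)%N.
Proof.
move=> incF; elim: n => // n IH; apply: leq_ltn_trans IH _.
exact/fproper_ltn_card/incF.
Qed.

Theorem theorem3p7 (R : realType) (G : groupType) (X : pmetricType R)
    (act : G -> X -> X) (F : nat -> {fset G}) (b : nat -> R) (f : X -> R)
    (mu : probability (borelType X) R) (Z : set X) (s : R)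
    (countG : countable [set: G]) (infG : infinite_set [set: G])
    (amenG : amenable R G)
    (cptX : compact [set: X]) (actG : continuous_action act)
    (folnerF : folner R F) (incrF : strictly_increasing F)
    (scaled_b : scaled_sequence b)
    (b_ge : forall n, (#|` F n|%fset)%:R <= b #|` F n|%fset)
    (contf : continuous f) :
  ((forall x, Z x -> (upper_local_pressure act F f b mu x <= s%:E)%E) ->
    (packing_pressure act F f b Z <= s%:E)%E) /\
  (measurable (Z : set (borelType X)) -> (0 < mu Z)%E ->
    (forall x, Z x -> (s%:E <= upper_local_pressure act F f b mu x)%E) ->
    (s%:E <= packing_pressure act F f b Z)%E).
Proof.
have [_ _ actC] := actG.
have [b_gt0 _ _] := scaled_b.
have b_ge_idx n : n%:R <= b #|` F n|%fset.
  by apply: le_trans (b_ge n); rewrite ler_nat leq_card_increasing.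
split=> [|mZ muZ]; first exact: packing_pressure_le.
by apply: packing_pressure_ge => //; rewrite measurable_mu_extE.
Qed.
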